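(* Let $\phi$ be a function-free first-order sentence, $(w,\bar w)$ a (real-valued) weighting on $\phi$, $d$ a domain size, and $\tau$ a tolerance. Let $(\mathit{LB},\mathit{UB})=\mathsf{ApproxWFOMC}(\phi,w,\bar w,d,\tau)$ be the output of the algorithm defined in the context. Suppose each $\mathsf{FOMC}$ oracle call made by the algorithm is answered by grounding the problem and calling the approximate model counter $\mathsf{ApproxMC3}$, the $i$-th call being made with tolerance $\varepsilon$ and confidence $1-\delta_i$. Then $$\Pr\left[\frac{\mathit{LB}}{1+\varepsilon}\ \le\ \mathsf{WFOMC}(\phi,d,w,\bar w)\ \le\ \mathit{UB}\,(1+\varepsilon)\right]\ \ge\ 1-\delta,$$ where $\delta=\sum_i\delta_i$, the sum being over the oracle calls $i=1,\dots,M$, with $M$ the number of calls to $\mathsf{ApproxMC3}$ made by $\mathsf{ApproxWFOMC}$.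
   Context: Logic and counts. First-order logic is function-free and interpreted over the finite domain $\mathbf{D}=\{1,\dots,d\}$; an interpretation assigns true or false to each of the $d^{\mathsf{arity}(P)}$ ground atoms of each predicate $P$. $\mathsf{models}_d(\phi)$ is the set of models of $\phi$ over $\mathbf{D}$, and $\mathsf{FOMC}(\phi,d)=|\mathsf{models}_d(\phi)|$. A weighting on $\phi$ is a pair of maps $w,\bar w$ from the set of predicates of $\phi$ to $\mathbb{R}$, and $$\mathsf{WFOMC}(\phi,d,w,\bar w)=\sum_{\omega\in\mathsf{models}_d(\phi)}\ \prod_{l\in\omega_T} w(\mathsf{pred}(l))\prod_{l\in\omega_F}\bar w(\mathsf{pred}(l)),$$ where $\omega_T$ (resp. $\omega_F$) is the set of ground atoms true (resp. false) in $\omega$ and $\mathsf{pred}(l)$ is the predicate of $l$. Approximate counter. Called with tolerance $\varepsilon>0$ and confidence $1-\delta_i\in(0,1]$ on an instance with true model count $c^*$, the randomized algorithm $\mathsf{ApproxMC3}$ returns a count $c$ with $\Pr\left(\frac{c^*}{1+\varepsilon}\le c\le(1+\varepsilon)c^*\right)\ge 1-\delta_i$ (a known guarantee). Algorithm $\mathsf{ApproxWFOMC}(\phi,w,\bar w,d,\tau)$. Let $W$ be the set of predicates $P$ of $\phi$ with $w(P)\ne 1$ or $\bar w(P)\ne 1$, and let $\xi_P=d^{\mathsf{arity}(P)}$. A constraint $a$ assigns to each $P\in W$ a pair of integers $(l_P,u_P)$ with $0\le l_P\le u_P\le\xi_P$; $\phi^{CARD}_a$ is the cardinality constraint saying that for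 each $P\in W$ the number of true ground instances of $P$ lies in $\{l_P,\dots,u_P\}$, and $\mathsf{FOMC}(\phi\land\phi^{CARD}_a,d)$ is the number of models of $\phi$ over $\mathbf{D}$ satisfying it. Put $$t_{\min}(a)=\prod_{P\in W}\min\!\big(w(P)^{l_P}\bar w(P)^{\xi_P-l_P},\,w(P)^{u_P}\bar w(P)^{\xi_P-u_P}\big),$$ and let $t_{\max}(a)$ be the same expression with $\max$ in place of $\min$. Initialization: obtain $c$ from an oracle call for $\mathsf{FOMC}(\phi,d)$; let $a_0$ be the constraint with all pairs $(0,\xi_P)$; set $\mathit{LB}=t_{\min}(a_0)\,c$ and $\mathit{UB}=t_{\max}(a_0)\,c$; store $(a_0,\mathit{LB},\mathit{UB})$ in a priority queue whose entries $(a,lb,ub)$ are ordered by decreasing $|ub-lb|$. Main loop: while $\mathit{UB}/\mathit{LB}\ge 1+\tau$ and the queue is nonempty: pop the first entry $(a,lb,ub)$. If $l_P=u_P$ for all $P\in W$, go to the next iteration (leaving $\mathit{LB},\mathit{UB}$ unchanged). Otherwise, for every $P\in W$ with $l_P\neq u_P$ split its pair into the two pairs $(l_P,\lfloor\frac{l_P+u_P}{2}\rfloor)$ and $(\lfloor\frac{l_P+u_P}{2}\rfloor+1,u_P)$, and for every $P\in W$ with $l_P=u_P$ keep its pair. Replace $\mathit{LB}$ by $\mathit{LB}-lb$ and $\mathit{UB}$ by $\mathit{UB}-ub$. For each constraint $a'$ obtained by choosing one of the resulting pairs for each $P\in W$ (all combinations): obtain $mc$ from an oracle call for $\mathsf{FOMC}(\phi\land\phi^{CARD}_{a'},d)$;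 add $t_{\min}(a')\,mc$ to $\mathit{LB}$ and $t_{\max}(a')\,mc$ to $\mathit{UB}$; push $(a',\,t_{\min}(a')\,mc,\,t_{\max}(a')\,mc)$ to the queue. When the loop ends, return $(\mathit{LB},\mathit{UB})$. Oracle calls are numbered $i=1,2,\dots,M$ in the order they are made.
   Formalization: The weights w and w̄ are assumed non-negative, since the claim fails for negative weights (e.g. one unary predicate with w=−1, w̄=1, d=2); as M is random, δ is read as the expectation of the sum of δ_i over the calls made. *)

(* Defs.v *)
From HB Require Import structures.
From mathcomp Require Import all_boot all_order all_algebra.
From mathcomp Require Import all_classical all_reals all_analysis.
From mathcomp Require Import zify.

Set Implicit Arguments.
Unset Strict Implicit.
Unset Printing Implicit Defensive.

Import Order.TTheory GRing.Theory Num.Theory.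

Local Open Scope ring_scope.

Record signature := Signature { predicate :> finType; arity : predicate -> nat }.

(* [formula S n] is the type of function-free formulas whose free variables
   are among n of them (well-scoped de Bruijn indices: a quantifier binds
   variable 0 and shifts the others).  Scoping keeps the empty domain
   meaningful, since a sentence is evaluated in the empty assignment. *)
Inductive formula (S : signature) : nat -> Type :=
| FAtom n (p : S) of (arity p).-tuple 'I_n : formula S n
| FEq n of 'I_n & 'I_n : formula S n
| FNot n of formula S n : formula S n
| FAnd n of formula S n & formula S n : formula S n
| FOr n of formula S n & formula S n : formula S n
| FForall n of formula S n.+1 : formula S n
| FExists n of formula S n.+1 : formula S n.

Definition sentence (S : signature) := formula S 0.

Definition ground_atom (S : signature) (d : nat) :=
  {p : S & (arity p).-tuple 'I_d}.

Definition interp (S : signature) (d : nat) := {ffun ground_atom S d -> bool}.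

Definition inst_atom (S : signature) d n (p : S) (args : (arity p).-tuple 'I_n)
    (e : n.-tuple 'I_d) : ground_atom S d :=
  Tagged (fun q : S => (arity q).-tuple 'I_d) [tuple of map (tnth e) args].

Fixpoint sat (S : signature) d n (om : interp S d) (f : formula S n) :
    n.-tuple 'I_d -> bool :=
  match f with
  | FAtom _ _ args => fun e => om (inst_atom args e)
  | FEq _ x y => fun e => tnth e x == tnth e y
  | FNot _ g => fun e => ~~ sat om g e
  | FAnd _ g h => fun e => sat om g e && sat om h e
  | FOr _ g h => fun e => sat om g e || sat om h e
  | FForall _ g => fun e => [forall x : 'I_d, sat om g [tuple of x :: e]]
  | FExists _ g => fun e => [exists x : 'I_d, sat om g [tuple of x :: e]]
  end.

Definition models (S : signature) (phi : sentence S) (d : nat) :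
    {set interp S d} := [set om : interp S d | sat om phi [tuple]]%SET.

Definition wfomc (R : realType) (S : signature) (phi : sentence S) (d : nat)
    (w wbar : S -> R) : R :=
  \sum_(om in models phi d)
    ((\prod_(g : ground_atom S d | om g) w (tag g)) *
     (\prod_(g : ground_atom S d | ~~ om g) wbar (tag g))).

(* Only the values at the non-trivially weighted predicates are meaningful. *)
Definition constr (S : signature) := {ffun S -> nat * nat}.

Section Counting.
Variables (S : signature) (d : nat) (phi : sentence S) (W : {set S}).

Definition instances (p : S) : {set ground_atom S d} :=
  [set g : ground_atom S d | tag g == p]%SET.

Definition sat_card (a : constr S) (om : interp S d) : bool :=
  [forall p in W,
    (a p).1 <= #|[set g in instances p | om g]%SET| <= (a p).2]%N.

(* [None] asks for FOMC(phi, d), [Some a] for FOMC(phi /\ card_a, d). *)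
Definition problem := option (constr S).

Definition fomc (q : problem) : nat :=
  #|[set om in models phi d | if q is Some a then sat_card a om else true]%SET|.

End Counting.

Inductive prop_form (V : Type) :=
| PTrue
| PVar of V
| PNot of prop_form V
| PAnd of prop_form V & prop_form V
| POr of prop_form V & prop_form V.
Arguments PTrue {V}.

Fixpoint prop_eval (V : finType) (om : {ffun V -> bool}) (f : prop_form V) :
    bool :=
  match f with
  | PTrue => true
  | PVar v => om v
  | PNot g => ~~ prop_eval om g
  | PAnd g h => prop_eval om g && prop_eval om h
  | POr g h => prop_eval om g || prop_eval om h
  end.

Definition model_count (V : finType) (f : prop_form V) : nat :=
  #|[set om : {ffun V -> bool} | prop_eval om f]%SET|.

Fixpoint ground (S : signature) (d n : nat) (f : formula S n) :
    n.-tuple 'I_d -> prop_form (ground_atom S d) :=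
  match f with
  | FAtom _ _ args => fun e => PVar (inst_atom args e)
  | FEq _ x y => fun e => if tnth e x == tnth e y then PTrue else PNot PTrue
  | FNot _ g => fun e => PNot (ground g e)
  | FAnd _ g h => fun e => PAnd (ground g e) (ground h e)
  | FOr _ g h => fun e => POr (ground g e) (ground h e)
  | FForall _ g => fun e =>
      \big[@PAnd _/PTrue]_(x : 'I_d) ground g [tuple of x :: e]
  | FExists _ g => fun e =>
      \big[@POr _/PNot PTrue]_(x : 'I_d) ground g [tuple of x :: e]
  end.

(* "l <= #true instances of p <= u" as a disjunction over the possible sets T
   of true instances of p. *)
Definition ground_card (S : signature) (d : nat) (W : {set S}) (a : constr S) :
    prop_form (ground_atom S d) :=
  \big[@PAnd _/PTrue]_(p in W)
    \big[@POr _/PNot PTrue]_(T in powerset (instances d p) |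
                             ((a p).1 <= #|T| <= (a p).2)%N)
      \big[@PAnd _/PTrue]_(g in instances d p)
        (if g \in T then PVar g else PNot (PVar g)).

Definition ground_problem (S : signature) (d : nat) (phi : sentence S)
    (W : {set S}) (q : problem S) : prop_form (ground_atom S d) :=
  if q is Some a then PAnd (ground phi [tuple]) (ground_card d W a)
  else ground phi [tuple].

Section Grounding.
Variables (S : signature) (d : nat).
Implicit Types om : interp S d.

Lemma eval_bigand om (I : Type) (r : seq I) (C : pred I) F :
  prop_eval om (\big[@PAnd _/PTrue]_(i <- r | C i) F i) =
  all (fun i => C i ==> prop_eval om (F i)) r.
Proof.
elim: r => [|i r IH]; first by rewrite big_nil.
by rewrite big_cons /= -IH; case: (C i).
Qed.

Lemma eval_bigor om (I : Type) (r : seq I) (C : pred I) F :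
  prop_eval om (\big[@POr _/PNot PTrue]_(i <- r | C i) F i) =
  has (fun i => C i && prop_eval om (F i)) r.
Proof.
elim: r => [|i r IH]; first by rewrite big_nil.
by rewrite big_cons /= -IH; case: (C i).
Qed.

Lemma eval_forall om (I : finType) (C : pred I) F :
  prop_eval om (\big[@PAnd _/PTrue]_(i | C i) F i) =
  [forall i, C i ==> prop_eval om (F i)].
Proof.
rewrite eval_bigand; apply/allP/forallP => [h i|h i _]; last exact: h.
exact/h/mem_index_enum.
Qed.

Lemma eval_exists om (I : finType) (C : pred I) F :
  prop_eval om (\big[@POr _/PNot PTrue]_(i | C i) F i) =
  [exists i, C i && prop_eval om (F i)].
Proof.
rewrite eval_bigor; apply/hasP/existsP => [[i _ h]|[i h]]; first by exists i.
by exists i => //; exact: mem_index_enum.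
Qed.

Lemma eval_ground om n (f : formula S n) (e : n.-tuple 'I_d) :
  prop_eval om (ground f e) = sat om f e.
Proof.
elim: f e => //= {n}.
- by move=> n x y e; case: ifP.
- by move=> n f IH e; rewrite IH.
- by move=> n f IHf g IHg e; rewrite IHf IHg.
- by move=> n f IHf g IHg e; rewrite IHf IHg.
- by move=> n f IH e; rewrite eval_forall; apply: eq_forallb => x; rewrite IH.
- by move=> n f IH e; rewrite eval_exists; apply: eq_existsb => x; rewrite IH.
Qed.

Lemma eval_ground_card om (W : {set S}) (a : constr S) :
  prop_eval om (ground_card d W a) = sat_card W a om.
Proof.
rewrite eval_forall; apply: eq_forallb => p; congr (_ ==> _).
rewrite eval_exists; apply/existsP/idP => [[T /andP[/andP[TI Tc]]]|Tc].
  rewrite eval_forall => /forallP h.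
  suff -> : [set g in instances d p | om g]%SET = T by [].
  apply/setP => g; rewrite inE.
  have := h g; case: (boolP (g \in instances d p)) => gI /=.
    by case: (g \in T) => //= /negbTE.
  move=> _; apply/esym/negbTE; apply: contra gI.
  by move: TI; rewrite inE => /fintype.subsetP; apply.
exists [set g in instances d p | om g]%SET; rewrite Tc andbT.
apply/andP; split; first by rewrite inE; apply/fintype.subsetP => g; rewrite inE => /andP[].
rewrite eval_forall; apply/forallP => g; apply/implyP => gI.
by rewrite !inE in gI *; rewrite gI /=; case: ifP => //= ->.
Qed.

Lemma model_count_ground (phi : sentence S) (W : {set S}) (q : problem S) :
  model_count (ground_problem d phi W q) = fomc d phi W q.
Proof.
apply: eq_card => om; rewrite !inE.
case: q => [a|] /=; first by rewrite eval_ground eval_ground_card.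
by rewrite eval_ground andbT.
Qed.

End Grounding.

Definition entry (R : Type) (S : signature) : Type := (constr S * R * R)%type.
Definition econstr R S (e : entry R S) : constr S := e.1.1.
Definition elb R S (e : entry R S) : R := e.1.2.
Definition eub R S (e : entry R S) : R := e.2.

(* [calls] lists the oracle calls made so far, in order. *)
Record state (R : Type) (S : signature) := State {
  LB : R;
  UB : R;
  queue : seq (entry R S);
  calls : seq (problem S) }.

Section Algorithm.
Variables (R : realType) (S : signature) (w wbar : S -> R) (d : nat) (tau : R).

Definition weighted : {set S} := [set p | (w p != 1) || (wbar p != 1)]%SET.

Definition xi (p : S) : nat := (d ^ arity p)%N.

Definition weight_at (p : S) (k : nat) : R := w p ^+ k * wbar p ^+ (xi p - k).

Definition tmin (a : constr S) : R :=
  \prod_(p in weighted) Num.min (weight_at p (a p).1) (weight_at p (a p).2).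

Definition tmax (a : constr S) : R :=
  \prod_(p in weighted) Num.max (weight_at p (a p).1) (weight_at p (a p).2).

Definition full_constr : constr S := [ffun p => (0%N, xi p)].

Definition unresolved (a : constr S) : {set S} :=
  [set p in weighted | (a p).1 != (a p).2]%SET.

(* The predicates of A get the upper half of their interval, the other
   unresolved ones the lower half. *)
Definition split_constr (a : constr S) (A : {set S}) : constr S :=
  [ffun p => if p \notin unresolved a then a p
             else let m := ((a p).1 + (a p).2)./2 in
                  if p \in A then (m.+1, (a p).2) else ((a p).1, m)].

Definition children (a : constr S) : seq (constr S) :=
  [seq split_constr a A | A <- enum (powerset (unresolved a))].

Definition push (e : entry R S) (q : seq (entry R S)) : seq (entry R S) :=
  sort (fun x y => `|eub y - elb y| <= `|eub x - elb x|) (rcons q e).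

(* In the sequel, [ans i] is the answer to the i-th oracle call (numbered from
   0, so that the next call has number [size (calls s)]). *)

Definition explore (ans : nat -> nat) (s : state R S) (a : constr S) :
    state R S :=
  let mc := (ans (size (calls s)))%:R in
  State (LB s + tmin a * mc) (UB s + tmax a * mc)
    (push (a, tmin a * mc, tmax a * mc) (queue s))
    (rcons (calls s) (Some a)).

Definition init (ans : nat -> nat) : state R S :=
  let c := (ans 0%N)%:R in
  let lb := tmin full_constr * c in
  let ub := tmax full_constr * c in
  State lb ub [:: (full_constr, lb, ub)] [:: None].

(* UB / LB >= 1 + tau, the ratio counting as infinite when LB = 0. *)
Definition too_wide (lb ub : R) : bool := (lb == 0) || (1 + tau <= ub / lb).

Definition active (s : state R S) : bool :=
  too_wide (LB s) (UB s) && (0 < size (queue s))%N.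

Definition step (ans : nat -> nat) (s : state R S) : state R S :=
  if queue s is e :: q then
    if unresolved (econstr e) == finset.set0 then
      State (LB s) (UB s) q (calls s)
    else
      foldl (explore ans)
        (State (LB s - elb e) (UB s - eub e) q (calls s))
        (children (econstr e))
  else s.

Definition wf_constr (a : constr S) : bool :=
  [forall p in weighted, (a p).1 <= (a p).2]%N.

Definition width (a : constr S) : nat :=
  (\sum_(p in weighted) ((a p).2 - (a p).1))%N.

Definition base : nat := (2 ^ #|S|).+1.

Definition queue_measure (q : seq (entry R S)) : nat :=
  (\sum_(e <- q) base ^ width (econstr e))%N.

Definition wf_queue (q : seq (entry R S)) : bool :=
  all (fun e => wf_constr (econstr e)) q.

Lemma wf_child a a' : wf_constr a -> a' \in children a -> wf_constr a'.
Proof.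
move=> /forall_inP wfa /mapP[A _ ->]; apply/forall_inP => p pW.
rewrite ffunE; case: ifPn => [_|]; first exact: wfa.
rewrite negbK inE => /andP[_ ne]; have := wfa p pW.
by case: (p \in A) => /=; lia.
Qed.

Lemma width_child a a' : wf_constr a -> unresolved a != finset.set0 ->
  a' \in children a -> (width a' < width a)%N.
Proof.
move=> /forall_inP wfa /finset.set0Pn[p0 p0U] /mapP[A _ ->].
have p0W : p0 \in weighted by move: p0U; rewrite inE => /andP[].
have lt_split p : p \in unresolved a ->
    ((split_constr a A p).2 - (split_constr a A p).1 < (a p).2 - (a p).1)%N.
  move=> pU; rewrite ffunE pU /=; move: pU; rewrite inE => /andP[pW ne].
  by have := wfa p pW; case: (p \in A) => /=; lia.
rewrite /width (bigD1 p0) //= [ltnRHS](bigD1 p0) //= -addSn.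
apply: leq_add; first exact: lt_split.
apply: leq_sum => p _; case: (boolP (p \in unresolved a)) => [/lt_split/ltnW //|pU].
by rewrite ffunE pU.
Qed.

Lemma explore_queue ans s l :
  perm_eq [seq econstr e | e <- queue (foldl (explore ans) s l)]
    ([seq econstr e | e <- queue s] ++ l).
Proof.
elim: l s => [|a l IH] s /=; first by rewrite cats0.
apply: perm_trans (IH _) _; rewrite /= -cat_rcons perm_cat2r /push.
set e := (X in rcons _ X); rewrite -[a]/(econstr e) -map_rcons.
by apply: perm_map; rewrite perm_sort.
Qed.

Lemma queue_measureE q :
  queue_measure q = (\sum_(a <- [seq econstr e | e <- q]) base ^ width a)%N.
Proof. by rewrite big_map. Qed.

Lemma wf_queueE q : wf_queue q = all wf_constr [seq econstr e | e <- q].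
Proof. by rewrite all_map. Qed.

Lemma step_wf ans s : wf_queue (queue s) -> wf_queue (queue (step ans s)).
Proof.
rewrite /step; case E: (queue s) => [|e q]; first by rewrite E.
move=> /= /andP[we wq]; case: ifP => // _.
rewrite wf_queueE (perm_all _ (explore_queue _ _ _)) all_cat -wf_queueE wq /=.
by apply/allP => a; exact: wf_child.
Qed.

Lemma step_measure ans s : wf_queue (queue s) -> active s ->
  (queue_measure (queue (step ans s)) < queue_measure (queue s))%N.
Proof.
rewrite /active /step => + /andP[_].
case E: (queue s) => [//|e q] /= /andP[we _] _.
have b0 k : (0 < base ^ k)%N by rewrite expn_gt0.
case: ifPn => [_|ne]; first by rewrite /queue_measure big_cons -addn1 addnC leq_add2r.
rewrite queue_measureE (perm_big _ (explore_queue _ _ _)) big_cat -queue_measureE /=.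
rewrite [ltnRHS]/queue_measure big_cons addnC ltn_add2r.
have w0 : (0 < width (econstr e))%N.
  have [p pU] := finset.set0Pn _ ne.
  apply: leq_ltn_trans (width_child (a' := split_constr (econstr e) finset.set0) we ne _).
    exact: leq0n.
  by apply: map_f; rewrite mem_enum inE finset.sub0set.
have le_children : (\sum_(a <- children (econstr e)) base ^ width a <=
    2 ^ #|S| * base ^ (width (econstr e)).-1)%N.
  apply: (@leq_trans (\sum_(a <- children (econstr e))
      base ^ (width (econstr e)).-1)%N).
    rewrite big_seq [leqRHS]big_seq; apply: leq_sum => a ac.
    by rewrite leq_exp2l // ?ltnS ?expn_gt0 //; have := width_child we ne ac; lia.
  rewrite big_const_seq count_predT iter_addn_0 mulnC leq_mul2r size_map.
  rewrite -cardE card_powerset leq_exp2l // max_card orbT //.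
apply: leq_ltn_trans le_children _.
rewrite -[in ltnRHS](prednK w0) expnS ltn_mul2r b0 //=.
Qed.

Lemma halts ans : exists n, ~~ active (iter n (step ans) (init ans)).
Proof.
have: wf_queue (queue (init ans)).
  by rewrite /= andbT; apply/forall_inP => p _; rewrite ffunE.
move: (init ans) => s; have [m] := ubnP (queue_measure (queue s)).
elim: m s => // m IH s le_m wf_s.
case: (boolP (active s)) => [act|nact]; last by exists 0%N.
have [|n hn] := IH (step ans s) _ (step_wf ans wf_s).
  by apply: leq_trans (step_measure ans wf_s act) _.
by exists n.+1; rewrite iterSr.
Qed.

(* The state in which the loop condition fails for the first time. *)
Definition approx_wfomc (ans : nat -> nat) : state R S :=
  iter (ex_minn (halts ans)) (step ans) (init ans).

End Algorithm.

(* A randomized counter is given by the law of its output, as a function of the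
   tolerance eps, of dlt (for the confidence 1 - dlt) and of the instance. *)
Definition approx_counter (R : realType) (V : finType)
    (mc : R -> R -> prop_form V -> probability nat R) : Prop :=
  forall (eps dlt : R) (f : prop_form V), 0 < eps -> 0 <= dlt < 1 ->
    ((1 - dlt)%:E <=
     mc eps dlt f [set c : nat |
       ((model_count f)%:R / (1 + eps) <= c%:R <= (1 + eps) * (model_count f)%:R)%R
     ]%classic)%E.

(* [ans] is the sequence of answers received by the algorithm.  Given that the
   first i answers were h 0, ..., h i.-1, and that the algorithm then makes an
   i-th call, the answer to that call is an output of [mc] (with parameters eps
   and delta i) on the grounding of the problem asked.  Both the existence of
   the i-th call and its problem depend on h 0, ..., h i.-1 only. *)
Definition answered_by (R : realType) (S : signature) (phi : sentence S)
    (w wbar : S -> R) (d : nat) (tau eps : R) (delta : nat -> R)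
    (mc : R -> R -> prop_form (ground_atom S d) -> probability nat R)
    (dO : measure_display) (Omega : measurableType dO) (P : probability Omega R)
    (ans : nat -> {RV P >-> nat}) : Prop :=
  forall (i : nat) (h : nat -> nat),
    let asked := calls (approx_wfomc w wbar d tau h) in
    let past := [set om | forall j, (j < i)%N -> ans j om = h j]%classic in
    (i < size asked)%N ->
    forall k : nat,
      P (past `&` ans i @^-1` [set k])%classic =
      (P past * mc eps (delta i)
         (ground_problem d phi (weighted w wbar) (nth None asked i))
         [set k]%classic)%E.

(* Main.v *)
(* Every constraint ever created and not split is either in the queue or was
   popped as resolved; together these constraints partition the
   interpretations.  For nonnegative weights, w^k wbar^(xi - k) is monotone in
   k, so the weight of a model satisfying a constraint lies between its tmin and
   tmax.  Hence, if all the oracle answers are within a factor 1 + eps, LB and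
   UB bracket the weighted count up to that factor.

   The number of calls is random but bounded, and whether an i-th call is made,
   and on which problem, depends on the first i answers only.  Conditioning on
   these answers, the i-th call is made and answered inaccurately with
   probability at most delta_i P[i-th call made]; the sum over i of these bounds
   is the expectation of the random sum of the delta_i. *)

Require Import Defs.
From HB Require Import structures.
From mathcomp Require Import all_boot all_order all_algebra.
From mathcomp Require Import all_classical all_reals all_analysis.
From mathcomp Require Import zify.

Import Order.TTheory GRing.Theory Num.Theory.

Local Open Scope classical_set_scope.
Local Open Scope ring_scope.

(** * Weights of interpretations, and their bounds under cardinality constraints *)

Section Weights.
Set Implicit Arguments.
Unset Strict Implicit.
Variables (R : realType) (S : signature) (w wbar : S -> R) (d : nat).
Implicit Types (p : S) (a : constr S) (om : interp S d).

Definition ntrue (p : S) om : nat := #|[set g in instances d p | om g]%SET|.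

Definition interp_weight om : R :=
  (\prod_(g : ground_atom S d | om g) w (tag g)) *
  (\prod_(g : ground_atom S d | ~~ om g) wbar (tag g)).

Lemma card_instances p : #|instances d p| = xi d p.
Proof.
rewrite /xi -[d in RHS]card_ord -card_tuple -cardsT.
rewrite -(@card_imset _ _ (fun t : (arity p).-tuple 'I_d =>
  Tagged (fun q : S => (arity q).-tuple 'I_d) t)); last first.
  by move=> t u /eqP; rewrite eq_Tagged => /eqP.
apply: eq_card => -[q t]; rewrite !inE /=; apply/eqP/imsetP => [qp|[u _ e]].
  by subst q; exists t.
exact: (f_equal (@projT1 _ _) e).
Qed.

Lemma ntrue_xi p om : (ntrue p om <= xi d p)%N.
Proof.
rewrite -card_instances; apply: subset_leq_card; apply/fintype.subsetP => g.
by rewrite inE => /andP[].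
Qed.

(** Ground atoms are grouped by predicate; outside [weighted] only powers of 1 arise. *)
Lemma interp_weightE om :
  interp_weight om =
  \prod_(p in weighted w wbar) weight_at w wbar d p (ntrue p om).
Proof.
transitivity (\prod_p weight_at w wbar d p (ntrue p om)); last first.
  rewrite (bigID (mem (weighted w wbar))) /= [X in _ * X]big1 ?mulr1 //.
  move=> p; rewrite inE negb_or !negbK => /andP[/eqP w1 /eqP wb1].
  by rewrite /weight_at w1 wb1 !expr1n mulr1.
rewrite /interp_weight (partition_big (@tag _ _) predT) //=.
rewrite [X in _ * X](partition_big (@tag _ _) predT) //= -big_split /=.
apply: eq_bigr => p _; congr (_ * _).
  rewrite (eq_bigr (fun=> w p)); last by move=> g /andP[_ /eqP ->].
  rewrite prodr_const; congr (_ ^+ _); apply: eq_card => g.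
  by rewrite !inE andbC.
rewrite (eq_bigr (fun=> wbar p)); last by move=> g /andP[_ /eqP ->].
rewrite prodr_const; congr (_ ^+ _); rewrite -card_instances.
rewrite -(cardsID [set g | om g]%SET (instances d p)).
rewrite (_ : (instances d p :&: [set g | om g])%SET =
             [set g in instances d p | om g]%SET) ?addKn.
  by apply: eq_card => g; rewrite !inE.
by apply/setP => g; rewrite !inE.
Qed.

Hypotheses (w_ge0 : forall p, 0 <= w p) (wbar_ge0 : forall p, 0 <= wbar p).

Lemma weight_at_ge0 p k : 0 <= weight_at w wbar d p k.
Proof. by rewrite mulr_ge0 ?exprn_ge0. Qed.

(** Passing from [k] to [l] trades [l - k] factors [wbar p] for as many factors [w p], so the
    direction of the inequality depends on neither [k] nor [l]. *)
Lemma weight_at_homo p k l : (k <= l <= xi d p)%N ->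
  if w p <= wbar p then weight_at w wbar d p l <= weight_at w wbar d p k
  else weight_at w wbar d p k <= weight_at w wbar d p l.
Proof.
move=> /andP[kl lx].
have eq_xi : (xi d p - k = (l - k) + (xi d p - l))%N by lia.
rewrite /weight_at eq_xi -[X in w p ^+ X * wbar p ^+ _ <= _](subnKC kl).
rewrite -[X in _ <= w p ^+ X * wbar p ^+ (_ - l)](subnKC kl) !exprD -!mulrA.
case: leP => [le|/ltW le]; rewrite ler_wpM2l ?exprn_ge0 //;
  by rewrite ler_wpM2r ?exprn_ge0 // lerXn2r ?nnegrE.
Qed.

Lemma weight_at_between p k l u : (l <= k <= u)%N -> (u <= xi d p)%N ->
  Num.min (weight_at w wbar d p l) (weight_at w wbar d p u)
    <= weight_at w wbar d p k
    <= Num.max (weight_at w wbar d p l) (weight_at w wbar d p u).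
Proof.
move=> /andP[lk ku] ux; rewrite ge_min le_max.
have kx := leq_trans ku ux.
have := @weight_at_homo p l k; have := @weight_at_homo p k u.
rewrite lk kx ku ux => /(_ isT) + /(_ isT).
by case: ifP => _ -> ->; rewrite ?orbT.
Qed.

(** Unlike [wf_constr], this includes the bound [xi d p], up to which the truncated subtraction in
    [weight_at] is exact. *)
Definition bounded_constr a : bool :=
  [forall p in weighted w wbar, (a p).1 <= (a p).2 <= xi d p]%N.

Lemma tmin_ge0 a : 0 <= tmin w wbar d a.
Proof. by apply: prodr_ge0 => p _; rewrite le_min !weight_at_ge0. Qed.

Lemma tmax_ge0 a : 0 <= tmax w wbar d a.
Proof. by apply: prodr_ge0 => p _; rewrite le_max !weight_at_ge0. Qed.

Lemma interp_weight_between a om :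
  bounded_constr a -> sat_card (weighted w wbar) a om ->
  tmin w wbar d a <= interp_weight om <= tmax w wbar d a.
Proof.
move=> /forall_inP ba /forall_inP sa; rewrite interp_weightE.
apply/andP; split; apply: ler_prod => p pW;
  have /andP[_ up] := ba p pW;
  have /andP[lo hi] := weight_at_between (sa p pW) up.
- by rewrite le_min !weight_at_ge0.
- by rewrite weight_at_ge0.
Qed.

Lemma bounded_child a a' :
  bounded_constr a -> a' \in children w wbar a -> bounded_constr a'.
Proof.
move=> /forall_inP ba /mapP[A _ ->]; apply/forall_inP => p pW.
have := ba p pW; rewrite ffunE inE pW /=; case: eqVneq => //= /eqP ne.
by case: (p \in A) => /= lu; lia.
Qed.

(** The two halves of an interval are disjoint and exhaust it, so the number of true instances
    dictates the half. The inclusion makes [A] unique, since [split_constr] ignores predicates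
    outside [unresolved]. *)
Lemma sat_split a (A : {set S}) om : A \subset unresolved w wbar a ->
  sat_card (weighted w wbar) (split_constr w wbar a A) om =
  sat_card (weighted w wbar) a om &&
  (A == [set p in unresolved w wbar a |
           ((a p).1 + (a p).2)./2 < ntrue p om]%N%SET).
Proof.
move=> /fintype.subsetP AU.
apply/forall_inP/andP => [h|[/forall_inP sa /eqP ->] p pW].
  split.
    apply/forall_inP => p pW; have := h p pW; rewrite ffunE inE pW /=.
    by case: eqP => //= ne; case: (p \in A) => /=; rewrite -/(ntrue p om); lia.
  apply/eqP/setP => p; rewrite finset.in_set.
  case: (boolP (p \in unresolved _ _ _)) => [pU|pU] /=.
    have pW : p \in weighted w wbar by move: pU; rewrite inE => /andP[].
    have := h p pW; rewrite ffunE pU /= -/(ntrue p om).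
    by case: (p \in A) => /= /andP[]; lia.
  by apply/negbTE; apply: contra pU => /AU.
have := sa p pW; rewrite ffunE -/(ntrue p om).
case: (boolP (p \in unresolved _ _ _)) => //= pU; rewrite finset.in_set pU /=.
by case: ltnP => /=; lia.
Qed.

(** By [sat_split] only the child built from [A0] can hold in [om], and the enumeration of subsets
    meets [A0] once. *)
Lemma count_children a om :
  count (fun a' => sat_card (weighted w wbar) a' om) (children w wbar a) =
  sat_card (weighted w wbar) a om.
Proof.
set A0 := [set p in unresolved w wbar a |
             ((a p).1 + (a p).2)./2 < ntrue p om]%N%SET.
rewrite count_map (@eq_in_count _ _ (fun A =>
  sat_card (weighted w wbar) a om && (A == A0))).
  case: sat_card => /=; last by rewrite count_pred0.
  rewrite count_uniq_mem ?enum_uniq // mem_enum powersetE.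
  rewrite (_ : _ \subset _) //; apply/fintype.subsetP => p.
  by rewrite !inE => /andP[].
by move=> A; rewrite mem_enum powersetE => /sat_split /= ->.
Qed.

End Weights.

(** * Growth of the list of calls *)

Section Trace.
Set Implicit Arguments.
Unset Strict Implicit.
Variables (R : realType) (S : signature) (w wbar : S -> R) (d : nat).
Implicit Types (a : constr S) (s : state R S).
Local Notation step := (step w wbar d).
Local Notation explore := (explore w wbar d).

Lemma calls_foldl ans s l :
  calls (foldl (explore ans) s l) = calls s ++ map Some l.
Proof.
by elim: l s => [|a l IH] s /=; rewrite ?cats0 // IH /= cat_rcons.
Qed.

Lemma prefix_step ans s : prefix (calls s) (calls (step ans s)).
Proof.
rewrite /Defs.step; case: (queue s) => [|e q] /=; first exact: prefix_refl.
by case: ifP => _ /=; rewrite ?prefix_refl // calls_foldl /= prefix_prefix.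
Qed.

End Trace.

(** * Accurate answers make the bounds bracket the weighted count *)

Section Bracketing.
Set Implicit Arguments.
Unset Strict Implicit.
Variables (R : realType) (S : signature) (phi : sentence S) (w wbar : S -> R).
Variables (d : nat) (eps : R) (ans : nat -> nat).
Hypotheses (w_ge0 : forall p, 0 <= w p) (wbar_ge0 : forall p, 0 <= wbar p).
Hypothesis eps_gt0 : 0 < eps.
Implicit Types (a : constr S) (s : state R S).
Local Notation W := (weighted w wbar).
Local Notation tmin := (tmin w wbar d).
Local Notation tmax := (tmax w wbar d).
Local Notation fomc := (fomc d phi W).
Local Notation step := (step w wbar d ans).
Local Notation explore := (explore w wbar d ans).
Local Notation init := (init w wbar d ans).

Definition accurate (n c : nat) : bool :=
  n%:R / (1 + eps) <= c%:R <= (1 + eps) * n%:R.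

Definition accurate_calls (qs : seq (problem S)) : Prop :=
  forall i, (i < size qs)%N -> accurate (fomc (nth None qs i)) (ans i).

Lemma accurate_calls_prefix qs qs' :
  prefix qs qs' -> accurate_calls qs' -> accurate_calls qs.
Proof.
move=> /prefixP[r ->] acc i isz; have := acc i.
by rewrite size_cat nth_cat isz; apply; rewrite ltn_addr.
Qed.

(** Each inequality is one half of the accuracy of an answer, scaled by [tmin] or [tmax]; in this
    form it can be summed over entries. *)
Definition accurate_entry (e : entry R S) : Prop :=
  [/\ bounded_constr w wbar d (econstr e),
      elb e <= (1 + eps) * (tmin (econstr e) * (fomc (Some (econstr e)))%:R)
    & tmax (econstr e) * (fomc (Some (econstr e)))%:R <= eub e * (1 + eps)].

Lemma accurate_entryP a (c : nat) :
  bounded_constr w wbar d a -> accurate (fomc (Some a)) c ->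
  accurate_entry (a, tmin a * c%:R, tmax a * c%:R).
Proof.
have e1 : 0 < 1 + eps by rewrite ltr_wpDl.
move=> ba /andP[lo hi]; split => //; rewrite /econstr /elb /eub /=.
  by rewrite mulrCA ler_wpM2l ?tmin_ge0.
by rewrite -mulrA ler_wpM2l ?tmax_ge0 // -ler_pdivrMr.
Qed.

(* The entries [D] are those popped with a resolved constraint: they have left
   the queue, but still contribute to [LB] and [UB]. *)
Definition bracketing s (D : seq (entry R S)) : Prop :=
  [/\ LB s = \sum_(e <- queue s ++ D) elb e,
      UB s = \sum_(e <- queue s ++ D) eub e
    & forall e, e \in queue s ++ D -> accurate_entry e].

Lemma bracketing_explore s D a : bounded_constr w wbar d a ->
  accurate_calls (calls (explore s a)) ->
  bracketing s D -> bracketing (explore s a) D.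
Proof.
move=> ba acc [lbE ubE ents].
set mc := ans (size (calls s)).
set e := (a, tmin a * mc%:R, tmax a * mc%:R) : entry R S.
(* Sorting only permutes the queue, so priorities do not affect the sums. *)
have pq : perm_eq (queue (explore s a) ++ D) (e :: (queue s ++ D)).
  rewrite -cat_cons perm_cat2r /= /push perm_sort perm_rcons perm_sym //.
split.
- by rewrite (perm_big _ pq) big_cons -lbE /= addrC.
- by rewrite (perm_big _ pq) big_cons -ubE /= addrC.
move=> e'; rewrite (perm_mem pq) inE => /orP[/eqP ->|]; last exact: ents.
apply: accurate_entryP => //.
have := acc (size (calls s)).
by rewrite /= size_rcons nth_rcons ltnn eqxx; apply.
Qed.

Lemma bracketing_foldl s D l : all (bounded_constr w wbar d) l ->
  accurate_calls (calls (foldl explore s l)) ->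
  bracketing s D -> bracketing (foldl explore s l) D.
Proof.
elim: l s => [|a l IH] s //= /andP[ba bl] acc brk.
apply: IH => //; apply: bracketing_explore => //.
by apply: accurate_calls_prefix acc; rewrite calls_foldl prefix_prefix.
Qed.

(** A count of 1 expresses covering and disjointness together. *)
Definition exact_cover (L : seq (entry R S)) : Prop :=
  forall om : interp S d, count (fun e => sat_card W (econstr e) om) L = 1%N.

Definition invariant s : Prop :=
  exists D, bracketing s D /\ exact_cover (queue s ++ D).

Lemma sat_full (om : interp S d) : sat_card W (full_constr S d) om.
Proof. by apply/forall_inP => p _; rewrite ffunE /= ntrue_xi. Qed.

Lemma invariant_init : accurate_calls (calls init) -> invariant init.
Proof.
move=> acc; exists [::]; split; last by move=> om; rewrite /= sat_full.
split; rewrite /= ?big_seq1 // => e; rewrite inE => /eqP ->.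
apply: accurate_entryP.
  by apply/forall_inP => p _; rewrite ffunE /= leqnn.
(* The first call is [None]; it has the same count as the full constraint, which every
   interpretation satisfies. *)
have := acc 0%N isT; rewrite /=; congr (accurate _ _).
by apply: eq_card => om; rewrite !inE sat_full.
Qed.

Lemma invariant_step s :
  accurate_calls (calls (step s)) -> invariant s -> invariant (step s).
Proof.
rewrite /Defs.step; case: s => lb ub [|e q] cs //= acc.
move=> [D [[/= lbE ubE ents] cov]]; rewrite /= in lbE ubE.
case: ifPn acc => [_ _|_ acc].
  (* A resolved entry moves from the queue to [D], leaving the whole collection unchanged up to
     order. *)
  exists (e :: D); have pq : perm_eq (q ++ e :: D) (e :: (q ++ D)).
    by rewrite perm_catC /= perm_cons perm_catC.
  split; last by move=> om; rewrite (permP pq) cov.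
  split => [||e'] /=; rewrite ?(perm_big _ pq) ?(perm_mem pq) //.
  exact: ents.
exists D; have be : bounded_constr w wbar d (econstr e).
  by have [] := ents e (mem_head _ _).
split.
  apply: bracketing_foldl => //.
    by apply/allP => a; exact: bounded_child.
  (* Subtracting the bounds of [e] leaves exactly the sums over the other entries. *)
  split => [||e' eq'] /=.
  - by rewrite lbE big_cons addrAC subrr add0r.
  - by rewrite ubE big_cons addrAC subrr add0r.
  - by apply: ents; rewrite inE eq' orbT.
move=> om; rewrite -(cov om) /= !count_cat addnA; congr (_ + _)%N.
(* By [count_children], the children together count [om] as often as their parent did. *)
have := permP (explore_queue w wbar d ans (State (lb - elb e) (ub - eub e) q cs)
  (children w wbar (econstr e))) (fun a => sat_card W a om).
by rewrite count_cat count_children !count_map addnC => <-.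
Qed.

Lemma invariant_wfomc s : invariant s ->
  LB s / (1 + eps) <= wfomc phi d w wbar <= UB s * (1 + eps).
Proof.
move=> [D [[-> -> ents] cov]]; set L := queue s ++ D in ents cov *.
have e1 : 0 < 1 + eps by rewrite ltr_wpDl.
(* Each model satisfies the constraint of exactly one entry, to which its weight is charged. *)
have -> : wfomc phi d w wbar = \sum_(e <- L)
    \sum_(om in [set om in models phi d | sat_card W (econstr e) om]%SET)
      interp_weight w wbar om.
  transitivity (\sum_(om in models phi d)
      \sum_(e <- L | sat_card W (econstr e) om) interp_weight w wbar om).
    by apply: eq_bigr => om _; rewrite big_const_seq cov /= addr0.
  rewrite (exchange_big_dep predT) //=; apply: eq_bigr => e _.
  by apply: eq_bigl => om; rewrite !finset.inE.
rewrite ler_pdivrMr // mulrC; apply/andP; split.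
  rewrite mulr_sumr big_seq [leRHS]big_seq; apply: ler_sum => e eL.
  have [be lo _] := ents e eL; apply: le_trans lo _.
  rewrite ler_pM2l // mulr_natr -sumr_const; apply: ler_sum => om.
  rewrite finset.inE => /andP[_].
  by move=> /(interp_weight_between w_ge0 wbar_ge0 be) /andP[].
rewrite mulr_suml big_seq [leRHS]big_seq; apply: ler_sum => e eL.
have [be _ hi] := ents e eL; apply: le_trans hi.
rewrite mulr_natr -sumr_const; apply: ler_sum => om.
rewrite finset.inE => /andP[_].
by move=> /(interp_weight_between w_ge0 wbar_ge0 be) /andP[].
Qed.

Lemma accurate_approx_wfomc tau :
  accurate_calls (calls (approx_wfomc w wbar d tau ans)) ->
  LB (approx_wfomc w wbar d tau ans) / (1 + eps) <= wfomc phi d w wbar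
    <= UB (approx_wfomc w wbar d tau ans) * (1 + eps).
Proof.
move=> acc; apply: invariant_wfomc; move: acc; rewrite /approx_wfomc.
elim: (ex_minn _) => [|n IH]; first exact: invariant_init.
rewrite iterS => acc; apply: invariant_step => //; apply: IH.
(* The calls of an earlier state form a prefix of the final ones and inherit their accuracy. *)
exact: accurate_calls_prefix (prefix_step _ _ _ _ _) acc.
Qed.

End Bracketing.

(** * Dependence of a run on past answers only *)

Section Nonanticipation.
Set Implicit Arguments.
Unset Strict Implicit.
Variables (R : realType) (S : signature) (w wbar : S -> R) (d : nat) (tau : R).
Implicit Types (a : constr S) (s : state R S) (h : nat -> nat).
Local Notation step := (step w wbar d).
Local Notation explore := (explore w wbar d).
Local Notation init := (init w wbar d).
Local Notation approx := (approx_wfomc w wbar d tau).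

(* Idling once the loop has ended puts two runs of different lengths in
   lockstep. *)
Definition idle_step h s := if active tau s then step h s else s.

Lemma prefix_idle_step h s : prefix (calls s) (calls (idle_step h s)).
Proof.
by rewrite /idle_step; case: ifP => _; rewrite ?prefix_step ?prefix_refl.
Qed.

(** By minimality of the stopping index every earlier state is active, so idling starts only there
    and then freezes the state. *)
Lemma approx_wfomc_idle h :
  exists n, forall k, (n <= k)%N -> iter k (idle_step h) (init h) = approx h.
Proof.
rewrite /approx_wfomc; case: ex_minnP => n nact minn; exists n => k /subnK <-.
rewrite iterD.
have -> : iter n (idle_step h) (init h) = iter n (step h) (init h).
  have: (n <= n)%N by []; elim: {1 3 4}n => // m IH ltmn.
  rewrite !iterS IH 1?ltnW // /idle_step.
  by case: ifPn => // /minn; rewrite leqNgt ltmn.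
by elim: (k - n)%N => // m IH; rewrite iterS IH /idle_step (negbTE nact).
Qed.

(** Runs whose answers agree below [i] can diverge only through the answer to call [i]. The problem
    of that call is then already fixed, hence the agreement on [i.+1] problems. *)
Definition sync (i : nat) s s' : Prop :=
  (s = s' /\ (size (calls s) <= i)%N) \/
  [/\ (i < size (calls s))%N, (i < size (calls s'))%N
    & take i.+1 (calls s) = take i.+1 (calls s')].

Lemma sync_prefix i s s' t t' :
  (i < size (calls s))%N -> (i < size (calls s'))%N ->
  take i.+1 (calls s) = take i.+1 (calls s') ->
  prefix (calls s) (calls t) -> prefix (calls s') (calls t') -> sync i t t'.
Proof.
move=> lti lti' tk /prefixP[r tE] /prefixP[r' tE']; right.
rewrite tE tE' !size_cat !ltn_addr //; split=> //.
by rewrite !takel_cat.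
Qed.

Variables (i : nat) (h h' : nat -> nat).
Hypothesis hh' : forall j, (j < i)%N -> h j = h' j.

Lemma sync_explore s s' a :
  sync i s s' -> sync i (explore h s a) (explore h' s' a).
Proof.
case=> [[<-]|[lti lti' tk]]; last first.
  by apply: sync_prefix lti lti' tk _ _ => /=; rewrite prefix_rcons.
rewrite leq_eqVlt => /orP[/eqP iE|lti]; last first.
  by left; rewrite /Defs.explore hh' //= size_rcons.
(* Here exactly [i] calls precede: both runs ask the same call [i], but may receive different
   answers. *)
by right; rewrite /= size_rcons iE.
Qed.

Lemma sync_foldl s s' l :
  sync i s s' -> sync i (foldl (explore h) s l) (foldl (explore h') s' l).
Proof. by elim: l s s' => //= a l IH s s' /sync_explore/IH. Qed.

Lemma sync_idle_step s s' :
  sync i s s' -> sync i (idle_step h s) (idle_step h' s').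
Proof.
case=> [[<- les]|[lti lti' tk]]; last first.
  by apply: sync_prefix lti lti' tk _ _; exact: prefix_idle_step.
rewrite /idle_step; case: ifP => _; last by left.
rewrite /Defs.step; case: (queue s) => [|e q]; first by left.
case: ifP => _; first by left.
by apply: sync_foldl; left.
Qed.

Lemma sync_approx : sync i (approx h) (approx h').
Proof.
have [n hn] := approx_wfomc_idle h; have [n' hn'] := approx_wfomc_idle h'.
rewrite -(hn (maxn n n')) ?leq_maxl // -(hn' (maxn n n')) ?leq_maxr //.
elim: (maxn n n') => [|k IH]; last by rewrite !iterS; exact: sync_idle_step.
(* Initialization already makes call 0: for [i = 0] the initial states may differ, but both have
   asked [None]. *)
case: (posnP i) => [->|i0]; first by right.
by left; rewrite /= /Defs.init hh'.
Qed.

Lemma approx_wfomc_asked : (i < size (calls (approx h)))%N ->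
  (i < size (calls (approx h')))%N /\
  nth None (calls (approx h)) i = nth None (calls (approx h')) i.
Proof.
case: sync_approx => [[_]|[_ lti' tk] _]; first by rewrite leqNgt => /negbTE ->.
by split=> //; rewrite -(nth_take _ (ltnSn i)) tk nth_take.
Qed.

(** Together with a uniform bound on the number of calls, this makes the output a function of
    finitely many answers. *)
Lemma approx_wfomc_local :
  (size (calls (approx h)) <= i)%N -> approx h = approx h'.
Proof. by case: sync_approx => [[->]//|[lti _ _]]; rewrite leqNgt lti. Qed.

End Nonanticipation.

(** * A bound on the number of calls, uniform in the answers *)

Section CallBound.
Set Implicit Arguments.
Unset Strict Implicit.
Variables (R : realType) (S : signature) (w wbar : S -> R) (d : nat) (tau : R).
Implicit Types (s : state R S) (h : nat -> nat).

Lemma size_children a : (size (children w wbar a) <= 2 ^ #|S|)%N.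
Proof.
by rewrite size_map -cardE card_powerset leq_exp2l // max_card.
Qed.

(** An active step makes at most [2 ^ #|S|] calls and lowers [queue_measure] by at least one, so the
    potential [pot] never increases; its initial value is the bound. *)
Lemma calls_bounded :
  exists N, forall h, (size (calls (approx_wfomc w wbar d tau h)) <= N)%N.
Proof.
pose pot s := (size (calls s) + 2 ^ #|S| * queue_measure w wbar (queue s))%N.
(* [queue_measure] reads constraints only, so zero bounds can stand for the initial ones, which
   depend on [h]. *)
pose e0 : entry R S := (full_constr S d, 0, 0).
exists (1 + 2 ^ #|S| * queue_measure w wbar [:: e0])%N => h.
have [n /(_ n (leqnn n)) <-] := approx_wfomc_idle w wbar d tau h.
set s0 := Defs.init w wbar d h.
pose sn := iter n (idle_step w wbar d tau h) s0; rewrite -/sn.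
suff [_ le_pot] : wf_queue w wbar (queue sn) /\ (pot sn <= pot s0)%N.
  apply: leq_trans (leq_addr _ _) (leq_trans le_pot _).
  by rewrite /pot /= /queue_measure !big_seq1.
rewrite {}/sn; elim: n => [|n [wf le_pot]].
  by split=> //=; rewrite andbT; apply/forall_inP => p _; rewrite ffunE.
rewrite iterS; move: (iter n _ _) wf le_pot => s wf le_pot.
rewrite /idle_step; case: ifP => // act; split; first exact: step_wf.
apply: leq_trans le_pot; rewrite /pot.
have lt_m := step_measure d h wf act.
have le_c : (size (calls (step w wbar d h s)) <= size (calls s) + 2 ^ #|S|)%N.
  rewrite /step; case: (queue s) => [|e q]; first exact: leq_addr.
  case: ifP => _ /=; first exact: leq_addr.
  by rewrite calls_foldl size_cat size_map /= leq_add2l size_children.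
apply: (leq_trans (leq_add le_c (leqnn _))).
by rewrite -addnA leq_add2l -mulnS leq_mul2l lt_m orbT.
Qed.

End CallBound.

(** * Measure theory along the fibers of a map with countably many values *)

Section CountableFibers.
Set Implicit Arguments.
Unset Strict Implicit.
Context (d : measure_display) (Omega : measurableType d) (R : realType).
Variables (T : countType) (X : Omega -> T).
Hypothesis mX : forall t, measurable (X @^-1` [set t]).

(** Indexing by codes turns the fibers into a sequence; a number that codes nothing gives the empty
    set. *)
Let fiber (n : nat) : set Omega := [set om | pickle_inv n = Some (X om)].

Let measurable_fiber n : measurable (fiber n).
Proof.
rewrite /fiber; case: (pickle_inv n) => [t|]; last first.
  by rewrite (_ : [set _ | _] = set0) //; apply/seteqP; split.
rewrite (_ : [set _ | _] = X @^-1` [set t]) //.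
by apply/seteqP; split => om /= => [[]|->].
Qed.

Let bigcup_fiber (A : set Omega) : \bigcup_n (A `&` fiber n) = A.
Proof.
apply/seteqP; split=> [om [n _ []]//|om Aom].
by exists (pickle (X om)) => //; split => //; rewrite /fiber /= pickleK_inv.
Qed.

Let trivIset_fiber (A : set Omega) : trivIset setT (fun n => A `&` fiber n).
Proof.
apply/trivIsetP => m n _ _ mn; apply/seteqP; split => // om [[_ fm] [_ fn]].
move/eqP: mn; apply.
have /= em := @pickle_invK T m; have /= en := @pickle_invK T n.
by rewrite fm /= in em; rewrite fn /= in en; rewrite -em -en.
Qed.

Lemma measurable_preimage_countable (A : set T) : measurable (X @^-1` A).
Proof.
rewrite -(bigcup_fiber (X @^-1` A)); apply: bigcup_measurable => n _.
have [[t [nt At]]|nA] := pselect (exists t, pickle_inv n = Some t /\ A t).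
  rewrite (_ : _ `&` _ = fiber n) //; apply/seteqP; split=> om => [[]//|fom].
  by split => //; move: fom; rewrite /fiber /= nt => -[<-].
rewrite (_ : _ `&` _ = set0) //; apply/seteqP; split=> om // [Aom fom].
by apply: nA; exists (X om).
Qed.

(** Sigma-additivity sums the fiberwise inequalities. The product form avoids conditional
    probabilities, so null fibers need no separate treatment. *)
Lemma le_measure_fibers (mu : {measure set Omega -> \bar R}) (c : R)
    (A B : set Omega) :
  0 <= c -> measurable A -> measurable B ->
  (forall t, mu (A `&` X @^-1` [set t]) <=
             c%:E * mu (B `&` X @^-1` [set t]))%E ->
  (mu A <= c%:E * mu B)%E.
Proof.
move=> c0 mA mB le_fib.
rewrite -[in leLHS](bigcup_fiber A) -[in leRHS](bigcup_fiber B).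
rewrite !measure_semi_bigcup ?bigcup_fiber //;
  try by move=> n; exact: measurableI.
rewrite -nneseriesZl //; apply: lee_nneseries => // n _.
rewrite /fiber; case: (pickle_inv n) => [t|]; last first.
  rewrite (_ : [set _ | _] = set0) ?setI0 ?measure0 ?mule0 //.
  by apply/seteqP; split.
rewrite (_ : [set _ | _] = X @^-1` [set t]) //.
by apply/seteqP; split => om /= => [[]|->].
Qed.

End CountableFibers.

(** * Events determined by finitely many answers *)

Section History.
Set Implicit Arguments.
Unset Strict Implicit.
Context (d : measure_display) (Omega : measurableType d) (R : realType).
Context (P : probability Omega R) (ans : nat -> {RV P >-> nat}).

Definition past (i : nat) (h : nat -> nat) : set Omega :=
  [set om | forall j, (j < i)%N -> ans j om = h j].

(** Unlike full answer sequences, tuples of fixed length form a countable type, as the results on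
    fibers require. *)
Definition history (i : nat) (om : Omega) : i.-tuple nat :=
  [tuple ans j om | j < i].

Lemma nth_history i j om : (j < i)%N -> nth 0%N (history i om) j = ans j om.
Proof.
by move=> ji; rewrite -(tnth_nth _ _ (Ordinal ji)) tnth_mktuple.
Qed.

(** [nth 0%N] continues [t] by zeros, but [past i] reads only the indices below [i]. *)
Lemma preimage_history i (t : i.-tuple nat) :
  history i @^-1` [set t] = past i (nth 0%N t).
Proof.
apply/seteqP; split => om /= => [<- j ji|pom]; first by rewrite nth_history.
apply: eq_from_tnth => j; rewrite tnth_mktuple pom //.
by rewrite -tnth_nth.
Qed.

Lemma measurable_ans i (A : set nat) : measurable (ans i @^-1` A).
Proof.
by rewrite -[X in measurable X]setTI; exact: (measurable_funPT (ans i)).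
Qed.

Lemma measurable_past i h : measurable (past i h).
Proof.
rewrite (_ : past i h = \bigcap_(j in `I_i) (ans j @^-1` [set h j])).
  by apply: bigcap_measurableType => j _; exact: measurable_ans.
by apply/seteqP; split => om pom j ji; exact: pom.
Qed.

Lemma measurable_history i t : measurable (history i @^-1` [set t]).
Proof. by rewrite preimage_history; exact: measurable_past. Qed.

Lemma measurable_local (n : nat) (Q : (nat -> nat) -> Prop) :
  (forall h h', (forall j, (j < n)%N -> h j = h' j) -> Q h -> Q h') ->
  measurable [set om | Q (fun j => ans j om)].
Proof.
move=> locQ.
rewrite (_ : [set om | _] = history n @^-1` [set t | Q (nth 0%N t)]).
  by apply: measurable_preimage_countable => t; exact: measurable_history.
apply/seteqP; split => om /=; apply: locQ => j jn; by rewrite nth_history.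
Qed.

End History.

(** * Probability of an inaccurate call, and the expected total of the [delta i] *)

Section UnionBound.
Set Implicit Arguments.
Unset Strict Implicit.
Variables (R : realType) (S : signature) (phi : sentence S).
Variables (w wbar : S -> R) (d : nat) (tau eps : R) (delta : nat -> R).
Variables (mc : R -> R -> prop_form (ground_atom S d) -> probability nat R).
Context (dO : measure_display) (Omega : measurableType dO).
Context (P : probability Omega R) (ans : nat -> {RV P >-> nat}).
Hypotheses (eps_gt0 : 0 < eps) (delta01 : forall i, 0 <= delta i < 1).
Hypothesis mcP : approx_counter mc.
Hypothesis ansP : answered_by phi w wbar tau eps delta mc ans.
Local Notation run h := (approx_wfomc w wbar d tau h).
Local Notation asked h := (calls (run h)).
Local Notation answers om := (fun i => ans i om).
Local Notation acc q := (accurate eps (fomc d phi (weighted w wbar) q)).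

Definition called (i : nat) : set Omega :=
  [set om | (i < size (asked (answers om)))%N].

Definition inaccurate_call (i : nat) : set Omega :=
  [set om | (i < size (asked (answers om)))%N /\
            ~~ acc (nth None (asked (answers om)) i) (ans i om)].

Lemma measurable_called i : measurable (called i).
Proof.
apply: (@measurable_local _ _ _ _ _ i (fun h => i < size (asked h))%N).
by move=> h h' hh' /(approx_wfomc_asked hh')[].
Qed.

Lemma measurable_inaccurate_call i : measurable (inaccurate_call i).
Proof.
(* Deciding inaccuracy also reads the answer to call [i] itself, hence [i.+1]. *)
apply: (@measurable_local _ _ _ _ _ i.+1 (fun h => (i < size (asked h))%N /\
  ~~ acc (nth None (asked h) i) (h i))) => h h' hh' [lti].
have hh'i j : (j < i)%N -> h j = h' j by move=> ji; apply: hh'; rewrite ltnW.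
have [lti' <-] := approx_wfomc_asked hh'i lti.
by rewrite hh'.
Qed.

Lemma counter_inaccurate i q :
  (mc eps (delta i) (ground_problem d phi (weighted w wbar) q)
     [set c | ~~ acc q c] <= (delta i)%:E)%E.
Proof.
have := mcP (ground_problem d phi (weighted w wbar) q) eps_gt0 (delta01 i).
rewrite model_count_ground; set f := ground_problem _ _ _ _ => lb.
rewrite (_ : [set c | _] = ~` [set c | acc q c]); last first.
  by apply/seteqP; split => c /= /negP.
rewrite probability_setC //.
rewrite leeBlDr ?fin_num_measure // -leeBlDl //.
Qed.

(** [answered_by] speaks of single answers; sigma-additivity extends it to every set of answers. *)
Lemma prob_ans_past i h (B : set nat) : (i < size (asked h))%N ->
  P (past ans i h `&` ans i @^-1` B) =
  (P (past ans i h) * mc eps (delta i)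
     (ground_problem d phi (weighted w wbar) (nth None (asked h) i)) B)%E.
Proof.
move=> lti; set f := ground_problem _ _ _ _.
have BE : B = \bigcup_(k in B) [set k].
  by apply/seteqP; split => [k Bk|k [j Bj ->]//]; exists k.
have tB : trivIset B (fun k : nat => [set k]).
  by move=> i1 i2 _ _ [x [-> ->]].
rewrite [in LHS]BE [in RHS]BE preimage_bigcup setI_bigcupr.
rewrite !measure_bigcup //.
- rewrite -(fineK (fin_num_measure P _ (measurable_past ans i h))).
  rewrite -nneseriesZl //; apply: eq_eseriesr => k _.
  rewrite fineK ?fin_num_measure //; last exact: measurable_past.
  exact: ansP.
- move=> k _; apply: measurableI; first exact: measurable_past.
  exact: measurable_ans.
- by move=> i1 i2 _ _ [om [[_ /= <-] [_ /= <-]]].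
Qed.

(** The bound is checked on each history of [i] answers, which determines whether call [i] is made
    and on which problem. *)
Lemma prob_inaccurate_call i :
  (P (inaccurate_call i) <= (delta i)%:E * P (called i))%E.
Proof.
have /andP[di0 _] := delta01 i.
apply: (@le_measure_fibers _ _ _ _ (history ans i)) => //.
- exact: measurable_history.
- exact: measurable_inaccurate_call.
- exact: measurable_called.
move=> t; rewrite preimage_history; set h := nth 0%N t.
have past_agree om : past ans i h om -> forall j, (j < i)%N -> h j = ans j om.
  by move=> pom j ji; rewrite pom.
have [lti|nlti] := boolP (i < size (asked h))%N.
  rewrite (_ : inaccurate_call i `&` _ = past ans i h `&`
      ans i @^-1` [set c | ~~ acc (nth None (asked h) i) c]); last first.
    apply/seteqP; split => om /= [].
      move=> [_ bad] pom.
      by have [_ ->] := approx_wfomc_asked (past_agree om pom) lti.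
    move=> pom bad.
    have [lti' qE] := approx_wfomc_asked (past_agree om pom) lti.
    by split=> //; split; rewrite ?lti' -?qE.
  rewrite (_ : called i `&` _ = past ans i h); last first.
    apply/seteqP; split => [om []//|om pom]; split => //.
    by have [] := approx_wfomc_asked (past_agree om pom) lti.
  rewrite [leLHS](prob_ans_past _ lti) muleC; apply: lee_wpmul2r => //.
  exact: counter_inaccurate.
rewrite (_ : inaccurate_call i `&` _ = set0) ?measure0 ?mule_ge0 ?lee_fin //.
apply/seteqP; split => om // [[lti _] pom]; move/negP: nlti; apply.
have agree j : (j < i)%N -> ans j om = h j by move=> /(past_agree om pom).
by have [] := approx_wfomc_asked agree lti.
Qed.

(** The random upper limit becomes the constant [N], the indicator of [called i] selecting the terms
    present; the integral is then exchanged with a finite sum. *)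
Lemma expected_sum_delta (N : nat) :
  (forall h, size (asked h) <= N)%N ->
  ('E_P[fun om => (\sum_(i < size (asked (answers om))) delta i)%R] =
   \sum_(i < N) (delta i)%:E * P (called i))%E.
Proof.
move=> leN; rewrite unlock.
under eq_integral => om _.
  rewrite (big_ord_widen_cond N (fun=> true) delta (leN _)) big_mkcond.
  rewrite -sumEFin /= (eq_bigr (fun i : 'I_N =>
    ((delta i)%:E * (\1_(called i) om)%:E)%E)); last first.
    move=> i _; rewrite indicE /called; case: ifPn => lti.
      by rewrite mem_set ?mule1.
    by rewrite memNset ?mule0 //; exact/negP.
  over.
rewrite ge0_integral_sum //.
- apply: eq_bigr => i _; have /andP[di0 _] := delta01 i.
  rewrite ge0_integralZl //.
  + by rewrite integral_indic ?setIT //; exact: measurable_called.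
  + apply/measurable_realfun.measurable_EFinP.
    by apply: measurable_realfun.measurable_indic; exact: measurable_called.
- move=> i; apply: measurable_funeM.
  apply/measurable_realfun.measurable_EFinP.
  by apply: measurable_realfun.measurable_indic; exact: measurable_called.
- by move=> i om _; have /andP[di0 _] := delta01 i; rewrite mule_ge0 // lee_fin.
Qed.

End UnionBound.

(** * The guarantee, by a union bound over the calls *)

Theorem theorem3 (R : realType) (S : signature) (phi : sentence S)
    (w wbar : S -> R) (d : nat) (tau eps : R) (delta : nat -> R)
    (mc : R -> R -> prop_form (ground_atom S d) -> probability nat R)
    (dO : measure_display) (Omega : measurableType dO) (P : probability Omega R)
    (ans : nat -> {RV P >-> nat})
    (w_ge0 : forall p, 0 <= w p) (wbar_ge0 : forall p, 0 <= wbar p)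
    (eps_gt0 : 0 < eps) (delta01 : forall i, 0 <= delta i < 1)
    (mcP : approx_counter mc)
    (ansP : answered_by phi w wbar tau eps delta mc ans) :
  let out (om : Omega) := approx_wfomc w wbar d tau (fun i => ans i om) in
  (1 - 'E_P[fun om => (\sum_(i < size (calls (out om))) delta i)%R] <=
   P [set om | (LB (out om) / (1 + eps) <= wfomc phi d w wbar
                  <= UB (out om) * (1 + eps))%R])%E.
Proof.
have [N leN] := calls_bounded w wbar d tau; cbv zeta.
rewrite (expected_sum_delta _ delta01 leN).
set G := [set om | _].
(* No run makes more than [N] calls, so the first [N] answers determine the output. *)
have mG : measurable G.
  apply: (@measurable_local _ _ _ _ _ N (fun h =>
    LB (approx_wfomc w wbar d tau h) / (1 + eps) <= wfomc phi d w wbar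
      <= UB (approx_wfomc w wbar d tau h) * (1 + eps))) => h h' hh'.
  by rewrite (approx_wfomc_local hh') ?leN.
rewrite -[G]setCK probability_setC; last exact: measurableC.
apply: leeB => //.
have mbad := measurable_inaccurate_call phi w wbar d tau eps ans.
pose bad := inaccurate_call phi w wbar d tau eps ans.
(* The union has a fixed range although the number of calls is random, because [bad i] contains only
   outcomes where call [i] is made. *)
apply: (@le_trans _ _ (\sum_(i < N) P (bad i))%E).
  apply: content_subadditive => [i _||om nG]; [exact: mbad|exact: measurableC|].
  rewrite -bigcup_mkord; apply: contrapT => nbad; apply: nG.
  apply: (accurate_approx_wfomc w_ge0 wbar_ge0 eps_gt0) => i lti.
  apply: contrapT => /negP nacc; apply: nbad.
  by exists i; [exact: leq_trans lti (leN _)|split].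
by apply: lee_sum => i _; exact: prob_inaccurate_call ansP _.
Qed.
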